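(* Let $\beta,\gamma$ be positive real parameters such that $\beta\ge\gamma$ and $\beta\gamma>1$, and let $\lambda^{\star}:=\left(\frac{\beta}{\gamma}\right)^{d^{\star}/2}$ where $d^{\star}:=\frac{\pi}{\arctan\sqrt{\beta\gamma-1}}$. Then for every $\lambda'<\lambda^{\star}$ there exists $\delta>0$ (depending only on $\beta,\gamma,\lambda'$) such that for every finite graph $G$ with minimum degree at least $2$, the polynomial $\lambda\mapsto Z_{\mathrm{spin}}(G;\beta,\gamma,\lambda)$ has no zero in the set $\{\lambda\in\mathbb{C}: |\operatorname{Im}\lambda|\le\delta,\ -\delta\le \operatorname{Re}\lambda\le\lambda'+\delta\}$.
   Context: For a finite graph $G=(V,E)$ and $\sigma:V\to\{0,1\}$, let $m_0(\sigma)$ (resp. $m_1(\sigma)$) be the number of edges with both endpoints assigned $0$ (resp. $1$), and $n_1(\sigma)$ the number of vertices assigned $1$. Then $Z_{\mathrm{spin}}(G;\beta,\gamma,\lambda)=\sum_{\sigma:V\to\{0,1\}}\beta^{m_0(\sigma)}\gamma^{m_1(\sigma)}\lambda^{n_1(\sigma)}$, viewed as a polynomial in the complex variable $\lambda$ with $\beta,\gamma$ fixed. The arctangent is the principal branch with values in $(-\pi/2,\pi/2)$. *)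

(* Defs.v *)
From HB Require Import structures.
From mathcomp Require Import all_boot all_order all_algebra.
From mathcomp Require Import reals exp trigo.
From mathcomp.real_closed Require Import complex.

Set Implicit Arguments.
Unset Strict Implicit.
Unset Printing Implicit Defensive.

Import Order.TTheory GRing.Theory Num.Theory.

Local Open Scope ring_scope.

(* A finite simple graph is a symmetric irreflexive relation e on a finType V;
   its edges are the unordered pairs {u, v} with e u v. *)
Section Graph.
Variables (V : finType) (e : rel V).

Definition edges : {set {set V}} := [set [set u; v] | u in V, v in V & e u v].

Definition degree (v : V) : nat := #|[set w | e v w]|.

(* Spins 0 and 1 are encoded by false and true. *)
Definition mono_edges (b : bool) (sigma : {ffun V -> bool}) : nat :=
  #|[set f in edges | [forall v in f, sigma v == b]]|.

Definition ones (sigma : {ffun V -> bool}) : nat := #|[set v | sigma v]|.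

Definition Zspin (K : comNzRingType) (beta gamma lambda : K) : K :=
  \sum_(sigma : {ffun V -> bool})
    beta ^+ mono_edges false sigma * gamma ^+ mono_edges true sigma
    * lambda ^+ ones sigma.

End Graph.

Section Threshold.
Variable R : realType.

Definition dstar (beta gamma : R) : R :=
  pi / atan (Num.sqrt (beta * gamma - 1)).

Definition lambdastar (beta gamma : R) : R :=
  (beta / gamma) `^ (dstar beta gamma / 2).

End Threshold.

(* Main.v *)
(* Expand Z over half-edges: an edge contributes beta + x + y + gamma x y, which
   is nonzero when - x and - y avoid a suitable disc, half-plane or disc
   complement L.  The map y = - (beta + x) / (1 + gamma x) is an involution with
   two conjugate fixed points, and any circle through their negatives bounds an L.
   Asano contraction at a vertex of degree d shows that - lambda is (radially a
   limit of) a product of d elements of L whenever Z vanishes.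
   The circle is chosen tangent, at these points, to the logarithmic spiral
   |u| = exp (s |arg u|) through them, for which lambdastar = exp (s pi).  A
   product p of at least two elements of L then satisfies
   |p| >= exp (s |arg p|); this can fail for a single element, whence the degree
   condition.  So Z has no zero with |lambda| < exp (s |arg (- lambda)|), and this
   open region, independent of the graph, contains [0, lambdastar[. *)

Require Import Defs.
From HB Require Import structures.
From mathcomp Require Import all_boot all_order all_algebra.
From mathcomp Require Import reals exp trigo.
From mathcomp.real_closed Require Import complex.
From mathcomp Require Import boolp classical_sets topology normedtype sequences.
From mathcomp Require Import derive ring lra.

Set Implicit Arguments.
Unset Strict Implicit.
Unset Printing Implicit Defensive.

Import Order.TTheory GRing.Theory Num.Theory.
Import numFieldNormedType.Exports.

Local Open Scope ring_scope.
Local Open Scope complex_scope.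

(** * The spiral and its tangent circle *)

Section Spiral.
Local Open Scope classical_set_scope.
Local Open Scope ring_scope.
Variable R : realType.
Implicit Types x y z : R.

Lemma is_derive_continuous_within (f df : R -> R) (a b : R) :
  (forall x, is_derive x 1 f (df x)) -> {within `[a, b], continuous f}.
Proof.
move=> fdf; apply: continuous_subspaceT => x.
exact/differentiable_continuous/derivable1_diffP.
Qed.

Lemma is_derive_ge0_le (f df : R -> R) (a b : R) : a <= b ->
  (forall x, is_derive x 1 f (df x)) ->
  (forall x, a <= x <= b -> 0 <= df x) -> f a <= f b.
Proof.
move=> ab fdf df0.
have [c cab fab] : exists2 c, c \in `[a, b] & f b - f a = df c * (b - a).
  by apply: MVT_segment => //; exact: is_derive_continuous_within fdf.
by rewrite -subr_ge0 fab mulr_ge0 ?subr_ge0 ?df0 // -in_itv.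
Qed.

Lemma is_derive_le0_ge (f df : R -> R) (a b : R) : a <= b ->
  (forall x, is_derive x 1 f (df x)) ->
  (forall x, a <= x <= b -> df x <= 0) -> f b <= f a.
Proof.
move=> ab fdf df0.
have [c cab fab] : exists2 c, c \in `[a, b] & f b - f a = df c * (b - a).
  by apply: MVT_segment => //; exact: is_derive_continuous_within fdf.
by rewrite -subr_le0 fab mulr_le0_ge0 ?subr_ge0 ?df0 // -in_itv.
Qed.

(* Up to a nonnegative factor, the derivative of spiral s t at x is
   kfun s x - kfun s t. *)
Definition kfun (s x : R) : R := (sin x + s * cos x) * expR (s * x).

Lemma is_derive_kfun (s x : R) :
  is_derive x 1 (kfun s) ((1 + s ^+ 2) * cos x * expR (s * x)).
Proof.
rewrite /kfun; apply: is_derive_eq.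
rewrite /GRing.scale /=; ring.
Qed.

Lemma kfun_le (s x y : R) : - (pi / 2) <= x -> x <= y -> y <= pi / 2 ->
  kfun s x <= kfun s y.
Proof.
move=> x0 xy y2; apply: (is_derive_ge0_le xy (is_derive_kfun s)) => z /andP[xz zy].
rewrite mulr_ge0 ?expR_ge0 // mulr_ge0 ?addr_ge0 ?sqr_ge0 //.
by rewrite cos_ge0_pihalf // (le_trans x0 xz) (le_trans zy y2).
Qed.

(* y ^+ 2 - B cos x y - A = 0 is the circle, in polar coordinates for 1 / u,
   that is tangent to the spiral y = exp (- s x) at x = t. *)
Definition Bcoef (s t : R) : R := 2 * s / kfun s t.
Definition Acoef (s t : R) : R :=
  expR (- (s * t)) ^+ 2 - Bcoef s t * cos t * expR (- (s * t)).

Definition spiral (s t x : R) : R :=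
  expR (- (s * x)) ^+ 2 - Bcoef s t * cos x * expR (- (s * x)) - Acoef s t.

Variables s t : R.
Hypotheses (s0 : 0 <= s) (t0 : 0 < t) (t2 : t < pi / 2).
Let A := Acoef s t.
Let B := Bcoef s t.

Ltac tlra := move: (s0) (t0) (t2) => ? ? ?; lra.

Lemma kfun_gt0 : 0 < kfun s t.
Proof.
rewrite mulr_gt0 ?expR_gt0 // ltr_wpDr ?mulr_ge0 //.
  by rewrite cos_ge0_pihalf //; tlra.
by rewrite sin_gt0_pihalf // t0.
Qed.

Lemma Bcoef_ge0 : 0 <= B.
Proof. by apply: divr_ge0 (ltW kfun_gt0); rewrite mulr_ge0. Qed.

(** [Bcoef] is normalized by [B * kfun s t = 2 * s]; substituting this makes the derivative vanish
    at t, which is the tangency. *)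
Lemma is_derive_spiral x : is_derive x 1 (spiral s t)
  (B * expR (- (s * x)) ^+ 2 * (kfun s x - kfun s t)).
Proof.
rewrite /spiral; apply: is_derive_eq.
rewrite /GRing.scale /= -/B.
have BK : B * kfun s t = 2 * s by rewrite /B /Bcoef divfK // gt_eqF // kfun_gt0.
have e1 : expR (- (s * x)) * expR (s * x) = 1.
  by rewrite mulrC expRxMexpNx_1.
set y := expR (- _) in e1 *.
transitivity (B * y * (sin x + s * cos x) * (y * expR (s * x))
              - y ^+ 2 * (B * kfun s t)); last by rewrite /(kfun s x); ring.
rewrite e1 BK; ring.
Qed.

Lemma spiral_t : spiral s t t = 0.
Proof. by rewrite /spiral /Acoef subrr. Qed.

(** [kfun s] increases on the quarter turn, so [spiral s t] decreases before t and increases after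
    it; its minimum is the tangency value 0. *)
Lemma spiral_ge0 x : 0 <= x <= pi / 2 -> 0 <= spiral s t x.
Proof.
move=> /andP[x0 x2]; rewrite -spiral_t.
have B2 z : 0 <= B * expR (- (s * z)) ^+ 2.
  by rewrite mulr_ge0 ?Bcoef_ge0 // sqr_ge0.
have [xt|tx] := leP x t.
  apply: (is_derive_le0_ge xt is_derive_spiral) => z /andP[xz zt].
  by rewrite mulr_ge0_le0 // subr_le0 kfun_le //; tlra.
apply: (is_derive_ge0_le (ltW tx) is_derive_spiral) => z /andP[xz zt].
by rewrite mulr_ge0 // subr_ge0 kfun_le //; tlra.
Qed.

(* The ray of angle x meets the region L at distance 1 / y. *)
Definition ray (x y : R) : Prop := y ^+ 2 - B * cos x * y - A <= 0.

Lemma sin_gt0_t : 0 < sin t. Proof. by rewrite sin_gt0_pihalf ?t0. Qed.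

(** This places the vertex [B * cos x / 2] of the quadratic at or below the spiral. Discarding the
    sine in [kfun s x] and using monotonicity gives s cos x exp (s x) <= [kfun s t]. *)
Lemma Bcos_le x : 0 <= x <= t -> B * cos x <= 2 * expR (- (s * x)).
Proof.
move=> /andP[x0 xt].
have K0 := kfun_gt0.
rewrite -(ler_pM2r (expR_gt0 (s * x))) -!mulrA [expR (- _) * _]mulrC.
rewrite expRxMexpNx_1 mulr1.
rewrite /B /Bcoef -?mulrA -[leRHS]mulr1 ler_pM2l // mulrCA ler_pdivrMl // mulr1.
apply: le_trans (_ : kfun s x <= _); last by apply: kfun_le => //; tlra.
rewrite /kfun mulrA ler_wpM2r ?expR_ge0 // ler_wpDl //.
by apply: sin_ge0_pi; tlra.
Qed.

Lemma Bcos_lt_t : B * cos t < 2 * expR (- (s * t)).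
Proof.
have K0 := kfun_gt0.
rewrite -(ltr_pM2r (expR_gt0 (s * t))) -!mulrA [expR (- _) * _]mulrC.
rewrite expRxMexpNx_1 mulr1.
rewrite /B /Bcoef -?mulrA -[ltRHS]mulr1 ltr_pM2l // mulrCA ltr_pdivrMl // mulr1.
by rewrite /kfun mulrA ltr_pM2r ?expR_gt0 // ltr_pwDl // sin_gt0_t.
Qed.

(* Along the ray of angle x the quadratic is nonnegative at Y = exp(-s x); the
   point is to exclude that Y lies below its smaller root.  When x <= t the
   vertex is at most Y.  Otherwise Y meets the vertex at an intermediate angle,
   where the discriminant is already nonpositive. *)
Lemma ray_le x y : 0 <= x <= pi / 2 -> ray x y -> y <= expR (- (s * x)).
Proof.
move=> x02 Fxy; rewrite leNgt; apply/negP => Yy.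
have := spiral_ge0 x02; rewrite /spiral -/A -/B.
set Y := expR (- (s * x)) in Yy * => FY.
have /andP[x0 x2] := x02.
have qx : Y + y <= B * cos x.
  have : (y - Y) * (y + Y - B * cos x) <= 0 by rewrite /ray in Fxy; tlra.
  by rewrite pmulr_rle0 ?subr_gt0 //; tlra.
have [xt|tx] := leP x t.
  by have := Bcos_le (introT andP (conj x0 xt)); rewrite -/Y; tlra.
pose q z := B * cos z - 2 * expR (- (s * z)).
have dq z : is_derive z 1 q (- (B * sin z) + 2 * s * expR (- (s * z))).
  by rewrite /q; apply: is_derive_eq; rewrite /GRing.scale /=; ring.
have qt : q t < 0 by have := Bcos_lt_t; rewrite /q; tlra.
have qx0 : 0 < q x by rewrite /q -/Y; tlra.
have [c ctx qc] : exists2 c, c \in `[t, x] & q c = 0.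
  apply: IVT => //; first exact: ltW.
    exact: is_derive_continuous_within dq.
  rewrite /Num.min /Num.max (lt_trans qt qx0); tlra.
move: ctx; rewrite in_itv /= => /andP[tc cx].
have {}cx : c < x.
  by rewrite lt_neqAle cx andbT; apply/eqP => cx'; move: qx0; rewrite -cx' qc ltxx.
have c02 : 0 <= c <= pi / 2 by tlra.
have Fc := spiral_ge0 c02; rewrite /spiral -/A -/B in Fc.
have cxc : cos x < cos c.
  rewrite ltr_cos // in_itv /=; have := pi_gt0 R; tlra.
have cosx0 : 0 <= cos x by rewrite cos_ge0_pihalf //; tlra.
have Yc0 := expR_gt0 (- (s * c)).
have Y0 : 0 < Y := expR_gt0 _.
rewrite /q in qc; set Z := expR (- (s * c)) in Fc qc Yc0.
have BZ : B * cos c = 2 * Z by tlra.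
have B0 := Bcoef_ge0; rewrite -/B in B0.
have BcZ : B * cos x < 2 * Z.
  rewrite -BZ ltr_pM2l // lt_neqAle B0 andbT; apply/eqP => B00.
  by move: BZ; rewrite -B00 mul0r; tlra.
rewrite BZ in Fc; rewrite /ray in Fxy.
have Bx0 : 0 <= B * cos x by rewrite mulr_ge0.
set b := B * cos x in Fxy qx BcZ Bx0 *.
(* At c the inequality [Fc] reads A <= - Z^2, so the discriminant b^2 + 4 A at x is negative and no
   real y is admissible. *)
have : b ^+ 2 < (2 * Z) ^+ 2 by rewrite ltr_pXn2r // nnegrE; tlra.
have := sqr_ge0 (2 * y - b).
nra.
Qed.


Lemma expRNs_le x y : x <= y -> expR (- (s * y)) <= expR (- (s * x)).
Proof. by move=> xy; rewrite ler_expR lerN2 ler_wpM2l. Qed.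

(** This is [spiral_ge0] at the angle pi / 2, where the linear term vanishes. *)
Lemma Acoef_le : A <= expR (- (s * pi)).
Proof.
have := @spiral_ge0 (pi / 2); rewrite /spiral cos_pihalf mulr0 mul0r subr0 -/A.
rewrite subr_ge0 -expRM_natl => h.
apply: le_trans (h _) _; first by have := pi_gt0 R; lra.
by rewrite ler_expR; lra.
Qed.

Lemma ray_obtuse x y : pi / 2 < x -> x <= pi -> 0 < y -> ray x y ->
  0 < A /\ y ^+ 2 <= A.
Proof.
move=> x2 xpi y0; rewrite /ray => F.
have c0 : cos x <= 0.
  have := @cos_ge0_pihalf R (pi - x); rewrite cosB cospi sinpi; lra.
have B0 := Bcoef_ge0; rewrite -/B in B0.
have Bc : B * cos x * y <= 0 by rewrite mulr_le0_ge0 ?mulr_ge0_le0 // ltW.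
have := exprn_gt0 2 y0; split; lra.
Qed.

Lemma ray_le1 x y : 0 <= x <= pi -> 0 < y -> ray x y -> y <= 1.
Proof.
move=> /andP[x0 xpi] y0 F; have [x2|x2] := leP x (pi / 2).
  have x02 : 0 <= x <= pi / 2 by rewrite x0.
  by apply: le_trans (ray_le x02 F) _; rewrite expR_le1 oppr_le0 mulr_ge0.
have [_ yA] := ray_obtuse x2 xpi y0 F.
rewrite -(@ler_pXn2r _ 2) ?nnegrE ?(ltW y0) ?ler01 // expr1n.
apply: le_trans yA (le_trans Acoef_le _).
by rewrite expR_le1 oppr_le0 mulr_ge0 // pi_ge0.
Qed.

(* sinh (u + v) = sinh u cosh v + cosh u sinh v, with w = e^u, m = e^v. *)
Lemma sinh_add_le (w m k ca sa cd sd : R) : 0 < w -> 0 < m -> 0 <= k ->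
  0 <= ca -> 0 <= sd -> cd <= 1 -> sa <= 1 ->
  k * ca * m <= m ^+ 2 - 1 ->
  (w * m) ^+ 2 - 1 <= k * (ca * cd + sa * sd) * (w * m) ->
  w ^+ 2 - 1 <= k * sd * w.
Proof.
move=> w0 m0 k0 ca0 sd0 cd1 sa1 hm hq; rewrite leNgt; apply/negP => hw.
have ksd : 0 <= k * sd * w by rewrite !mulr_ge0 // ltW.
have kca : 0 <= k * ca * m by rewrite !mulr_ge0 // ltW.
have h1 : 2 * m * (k * sd * w) < (m ^+ 2 + 1) * (w ^+ 2 - 1).
  apply: lt_le_trans (_ : 2 * m * (w ^+ 2 - 1) <= _).
    by rewrite ltr_pM2l // mulr_gt0.
  by rewrite ler_wpM2r; have := sqr_ge0 (m - 1); lra.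
have h2 : 2 * w * (k * ca * m) <= (w ^+ 2 + 1) * (m ^+ 2 - 1).
  apply: ler_pM => //; first by rewrite mulr_ge0 // ltW.
  by have := sqr_ge0 (w - 1); lra.
have h3 : k * (ca * cd + sa * sd) * (w * m) <= k * (ca + sd) * (w * m).
  apply: ler_wpM2r; first by rewrite mulr_ge0 // ltW.
  by apply: ler_wpM2l => //; apply: lerD; rewrite ?ler_piMr // ler_piMl.
have : (w * m) ^+ 2 - 1 =
  ((m ^+ 2 + 1) * (w ^+ 2 - 1) + (w ^+ 2 + 1) * (m ^+ 2 - 1)) / 2 by field.
lra.
Qed.

(* Rays x and pi - x have lengths multiplying to A.  If x1 + x2 < pi, the length
   y1 y2 / sqrt A is admissible on the ray x1 + x2 - pi / 2, which is acute. *)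
Lemma ray_pair_obtuse x1 y1 x2 y2 : pi / 2 < x1 -> x1 <= pi -> 0 <= x2 <= pi ->
  0 < y1 -> 0 < y2 -> ray x1 y1 -> ray x2 y2 ->
  y1 * y2 <= expR (- (s * Num.min pi (x1 + x2))).
Proof.
move=> x12 x1pi /andP[x20 x2pi] y10 y20 F1 F2.
have [A0 _] := ray_obtuse x12 x1pi y10 F1.
have B0 := Bcoef_ge0; rewrite -/B in B0.
have Api := Acoef_le.
pose a := pi - x1.
have cx1 : cos x1 = - cos a by rewrite /a cosB cospi sinpi; lra.
have ca0 : 0 <= cos a by rewrite cos_ge0_pihalf // /a; lra.
(* If a <= x2 then x1 + x2 >= pi, the target is exp (- s pi), and y1 y2 <= A suffices. *)
have [ax2|x2a] := leP a x2.
  apply: le_trans (expRNs_le (_ : _ <= pi)); last by rewrite ge_min lexx.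
  apply: le_trans Api; rewrite leNgt; apply/negP => AY.
  have cx2 : cos x2 <= cos a.
    move: (ax2); rewrite le_eqVlt => /predU1P[->//|lt_ax2].
    by rewrite ltW // ltr_cos // in_itv /=; move: lt_ax2; rewrite /a; lra.
  rewrite /ray cx1 in F1; rewrite /ray in F2.
  have B2 : B * cos x2 <= B * cos a by rewrite ler_wpM2l.
  have Bca : 0 <= B * cos a by rewrite mulr_ge0.
  (* [F2] with A < y1 y2 allows a division by y2; multiplying the result by y1 then contradicts
     [F1]. *)
  have y2l : y2 < y1 + B * cos a.
    have : B * cos x2 * y2 <= B * cos a * y2 by rewrite ler_wpM2r // ltW.
    by rewrite -(ltr_pM2r y20); lra.
  have : y1 * y2 < y1 * (y1 + B * cos a) by rewrite ltr_pM2l.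
  lra.
apply: le_trans (expRNs_le (_ : _ <= x1 + x2)); last by rewrite ge_min lexx orbT.
pose al := Num.sqrt A.
have al0 : 0 < al by rewrite sqrtr_gt0.
have alA : al ^+ 2 = A by rewrite sqr_sqrtr // ltW.
pose d := a - x2.
have d0 : 0 < d by rewrite /d; lra.
have dp : d <= pi / 2 by rewrite /d /a; lra.
have cb : cos x2 = cos a * cos d + sin a * sin d.
  by rewrite -cosB; congr cos; rewrite /d; ring.
pose Y := y1 * y2 / al.
have Y0 : 0 < Y by rewrite /Y divr_gt0 // mulr_gt0.
have alK u v : u / al ^+ 2 - 1 <= v / al ^+ 2 <-> u - al ^+ 2 <= v.
  have a20 : 0 < al ^+ 2 by rewrite exprn_gt0.
  rewrite -[in X in X <-> _](ler_pM2r a20) mulrBl !divfK ?mul1r //.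
    by rewrite gt_eqF.
  by rewrite gt_eqF.
have FY : ray (pi / 2 - d) Y.
  rewrite /ray -(opprB d) cosN cosBpihalf -alA.
  have sd0 : 0 <= sin d by apply: sin_ge0_pi; have := pi_ge0 R; lra.
  (* Dividing lengths by sqrt A normalizes the constant term to 1. Here w = Y / al and m = al / y1,
     the reflected first ray, so that w m = y2 / al. *)
  have := @sinh_add_le (Y / al) (al / y1) (B / al) (cos a) (sin a) (cos d) (sin d).
  rewrite -cb => H.
  have : (Y / al) ^+ 2 - 1 <= B / al * sin d * (Y / al).
    apply: H; rewrite ?divr_gt0 ?mulr_gt0 ?(divr_ge0 B0 (ltW al0)) ?cos_le1 ?sin_le1 //.
    - rewrite -subr_ge0.
      have -> : (al / y1) ^+ 2 - 1 - B / al * cos a * (al / y1) =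
        (al ^+ 2 - y1 ^+ 2 - B * cos a * y1) / y1 ^+ 2.
        by field; rewrite !gt_eqF.
      rewrite divr_ge0 ?sqr_ge0 // alA.
      by move: F1; rewrite /ray cx1; lra.
    - have -> : Y / al * (al / y1) = y2 / al by rewrite /Y; field; rewrite !gt_eqF.
      have -> : B / al * cos x2 * (y2 / al) = B * cos x2 * y2 / al ^+ 2.
        by field; rewrite gt_eqF.
      by rewrite expr_div_n; apply/alK; rewrite alA; move: F2; rewrite /ray; lra.
  have -> : B / al * sin d * (Y / al) = B * sin d * Y / al ^+ 2.
    by field; rewrite gt_eqF.
  by rewrite expr_div_n => /alK; lra.
have Yle : Y <= expR (- (s * (pi / 2 - d))) by apply: ray_le FY; tlra.
have -> : y1 * y2 = al * Y by rewrite /Y; field; rewrite gt_eqF.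
have -> : - (s * (x1 + x2)) = - (s * (pi / 2)) + - (s * (pi / 2 - d)).
  by rewrite /d /a; field.
rewrite expRD; apply: ler_pM; rewrite ?(ltW al0) ?(ltW Y0) //.
rewrite -(@ler_pXn2r _ 2) ?nnegrE ?expR_ge0 ?(ltW al0) // alA -expRM_natl.
apply: le_trans Api _; rewrite ler_expR; lra.
Qed.

Lemma ray_pair x1 y1 x2 y2 : 0 <= x1 <= pi -> 0 <= x2 <= pi ->
  0 < y1 -> 0 < y2 -> ray x1 y1 -> ray x2 y2 ->
  y1 * y2 <= expR (- (s * Num.min pi (x1 + x2))).
Proof.
move=> x1I x2I y10 y20 F1 F2.
have [x12|x12] := ltP (pi / 2) x1.
  by apply: ray_pair_obtuse => //; case/andP: x1I.
have [x22|x22] := ltP (pi / 2) x2.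
  by rewrite mulrC addrC; apply: ray_pair_obtuse => //; case/andP: x2I.
apply: le_trans (expRNs_le (_ : _ <= x1 + x2)); last by rewrite ge_min lexx orbT.
rewrite mulrDr opprD expRD.
by apply: ler_pM; rewrite ?(ltW y10) ?(ltW y20) // ray_le //; lra.
Qed.

End Spiral.

(** * Asano contraction *)

(* If (z1, z2) is nonvanishing, solving for one variable at a time gives a pair
   of zeros w1, w2 whose product is again p. *)
Lemma asano_swap (F : fieldType) (S1 S2 : F -> Prop) (a b c d p z1 z2 : F) :
  S1 0 -> S2 0 ->
  (forall x y, S1 x -> S2 y -> a + b * x + c * y + d * x * y != 0) ->
  a = d * p -> z1 * z2 = p -> S1 z1 -> S2 z2 ->
  exists w1 w2, [/\ ~ S1 w1, ~ S2 w2 & w1 * w2 = p].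
Proof.
move=> S10 S20 nz ap zp Sz1 Sz2.
have a0 : a != 0 by have := nz _ _ S10 S20; rewrite !(mulr0, addr0).
have e0 : a + b * z1 != 0 by have := nz _ _ Sz1 S20; rewrite !(mulr0, addr0).
have e0' : a + c * z2 != 0.
  by have := nz _ _ S10 Sz2; rewrite !(mulr0, mul0r, addr0).
have d0 : d != 0 by apply: contraNneq a0 => d0; rewrite ap d0 mul0r.
have aE : a = d * z1 * z2 by rewrite ap -zp mulrA.
have eb : z1 * (b + d * z2) = a + b * z1 by rewrite aE; ring.
have ec : z2 * (c + d * z1) = a + c * z2 by rewrite aE; ring.
have nb : b + d * z2 != 0.
  by apply: contraNneq e0 => h; rewrite -eb h mulr0.
have nc : c + d * z1 != 0.
  by apply: contraNneq e0' => h; rewrite -ec h mulr0.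
exists (- (a + c * z2) / (b + d * z2)), (- (a + b * z1) / (c + d * z1)); split.
- move=> /nz /(_ Sz2) /negP; apply; apply/eqP; field.
  exact: nb.
- move=> /(nz _ _ Sz1) /negP; apply; apply/eqP; field.
  exact: nc.
- rewrite -zp -eb -ec; field.
  by rewrite nb nc.
Qed.

Section Radial.
Variables (R : realType) (L : R[i] -> Prop).

(* The quantification over t closes radially the set of products of k elements
   of L. *)
Definition prodset (k : nat) (p : R[i]) : Prop :=
  forall t : R, 1 < t -> exists2 tau : R, 0 < tau <= t &
  exists2 l : seq R[i], size l = k /\ (forall u, u \in l -> L u) &
    tau%:C * p = \prod_(u <- l) u.

Lemma prodset0_1 : prodset 0 1.
Proof.
move=> t t1; exists 1; first by rewrite ltr01 ltW.
by exists [::]; rewrite ?big_nil ?mulr1.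
Qed.

Lemma sub_prodset1 u : L u -> prodset 1 u.
Proof.
move=> Lu t t1; exists 1; first by rewrite ltr01 ltW.
exists [:: u]; last by rewrite big_seq1 mul1r.
by split=> // v; rewrite inE => /eqP ->.
Qed.

Lemma prodset_mul k m p q : prodset k p -> prodset m q -> prodset (k + m) (p * q).
Proof.
move=> Np Nq t t1.
have t0 : 0 <= t by lra.
have s1 : 1 < Num.sqrt t by rewrite -[ltLHS]sqrtr1 ltr_sqrt //; lra.
have [a /andP[a0 at_] [l [sl Ll] lE]] := Np _ s1.
have [b /andP[b0 bt] [m' [sm Lm] mE]] := Nq _ s1.
exists (a * b).
  rewrite mulr_gt0 //= -[t in leRHS]sqr_sqrtr // expr2.
  by rewrite ler_pM // ltW.
exists (l ++ m').
  split; first by rewrite size_cat sl sm.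
  by move=> u; rewrite mem_cat => /orP[/Ll|/Lm].
by rewrite big_cat /= -lE -mE rmorphM /=; ring.
Qed.

Hypothesis L_neq0 : ~ L 0.

Lemma prodset_neq0 k : ~ prodset k 0.
Proof.
have lt12 : 1 < 2 :> R by lra.
move=> /(_ _ lt12)[tau _ [l [_ Ll] /eqP]].
rewrite mulr0 eq_sym prodf_seq_eq0 => /hasP[u ul /= /eqP u0].
by apply: L_neq0; rewrite -u0; exact: Ll.
Qed.

(* c is the point where L first meets the positive real axis. *)
Variable c : R.
Hypotheses (c0 : 0 < c) (Lc : L c%:C).
Hypothesis Lltc : forall x : R, 0 < x < c -> ~ L x%:C.

Lemma prodset1_ltc (x : R) : 0 < x < c -> ~ prodset 1 x%:C.
Proof.
move=> /andP[x0 xc] Nx.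
(* Any tolerance below c / x keeps the scaled point [tau * x] below c. *)
pose t := (1 + c / x) / 2.
have cx : 1 < c / x by rewrite ltr_pdivlMr // mul1r.
have [tau /andP[tau0 taut] [l [sl Ll] lE]] := Nx t ltac:(rewrite /t; lra).
case: l sl Ll lE => [//|u [|//]] _ Ll; rewrite big_seq1 -rmorphM /= => uE.
apply: (@Lltc (tau * x)); last by rewrite uE; apply: Ll; rewrite mem_head.
rewrite mulr_gt0 //= -ltr_pdivlMr //; apply: le_lt_trans taut _; rewrite /t; lra.
Qed.

(** As x tends to c from below, the factor x is replaced by the element c of L; the ratio c / x is
    absorbed by the radial closure. *)
Lemma prodset_div k p :
  (forall x : R, 0 < x < c -> prodset k (p / x%:C)) -> prodset k.+1 p.
Proof.
move=> Np t t1.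
have t0 : 0 <= t by lra.
have s1 : 1 < Num.sqrt t by rewrite -[ltLHS]sqrtr1 ltr_sqrt //; lra.
have s0 : 0 < Num.sqrt t by lra.
set s := Num.sqrt t in s1 s0.
have xc : 0 < c / s < c by rewrite divr_gt0 //= ltr_pdivrMr // ltr_pMr.
have [a /andP[a0 at_] [l [sl Ll] lE]] := Np _ xc _ s1.
exists (a * s).
  by rewrite mulr_gt0 //= -[t in leRHS]sqr_sqrtr // expr2 ler_pM2r.
exists (c%:C :: l).
  by split; rewrite /= ?sl // => u; rewrite inE => /predU1P[->//|/Ll].
rewrite big_cons -lE !rmorphM /= fmorphV /=; field.
by rewrite !fmorph_eq0 !gt_eqF.
Qed.

Lemma asano_prodset k (a b c' d z : R[i]) :
  (forall x y, ~ prodset k (- x) -> ~ prodset 1 (- y) ->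
     a + b * x + c' * y + d * x * y != 0) ->
  ~ prodset k.+1 (- z) -> a + d * z != 0.
Proof.
move=> nz Nz; apply/negP => /eqP adz; apply: Nz.
have ap : a = d * - z by rewrite mulrN; apply/eqP; rewrite -addr_eq0 adz.
have [[z1 [z2 [zp N1 N2]]]|noz] := pselect (exists z1 z2,
    [/\ z1 * z2 = - z, ~ prodset k (- z1) & ~ prodset 1 (- z2)]).
  have [|| w1 [w2 [w1N w2N <-]]] := asano_swap _ _ nz ap zp N1 N2.
  - by rewrite oppr0; exact: prodset_neq0.
  - by rewrite oppr0; exact: prodset_neq0.
  move/contrapT: w1N => w1N; move/contrapT: w2N => w2N.
  by rewrite -mulrNN -addn1; exact: prodset_mul.
apply: prodset_div => x xc; apply: contrapT => Nx.
have x0 : x%:C != 0 by rewrite fmorph_eq0 gt_eqF //; case/andP: xc.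
apply: noz; exists (z / x%:C), (- x%:C); split.
- by field.
- by rewrite -mulNr.
- by rewrite opprK; exact: prodset1_ltc.
Qed.

(* A variable y is represented by homogeneous coordinates (1, y), so that the
   coefficient of a top monomial is a value at (0, 1). *)
Definition upd (T : eqType) (s : seq T) (c : R[i] * R[i]) (x : T -> R[i] * R[i]) :=
  fun t => if t \in s then c else x t.

Lemma upd_nil (T : eqType) c1 (x : T -> R[i] * R[i]) : upd [::] c1 x = x.
Proof. by apply/funext => t. Qed.

Lemma upd_cons (T : eqType) (t : T) s c1 x :
  upd (t :: s) c1 x = upd s c1 (upd [:: t] c1 x).
Proof. by apply/funext => u; rewrite /upd !inE; case: eqP; case: ifP. Qed.

Lemma upd_swap (T : eqType) (t : T) s c1 c2 x : t \notin s ->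
  upd s c1 (upd [:: t] c2 x) = upd [:: t] c2 (upd s c1 x).
Proof.
move=> ts; apply/funext => u; rewrite /upd !inE; case: eqP => // ->.
by rewrite (negPf ts).
Qed.

Definition linear_at (T : eqType) (G : (T -> R[i] * R[i]) -> R[i]) (t : T) :=
  forall x a b, G (upd [:: t] (a, b) x) =
    a * G (upd [:: t] (1, 0) x) + b * G (upd [:: t] (0, 1) x).

(** The variables of s are merged one by one into z. Freezing the variable of t at (1, z2), the
    induction hypothesis gives the nonvanishing in z1 and z2 that [asano_prodset] needs. *)
Lemma contraction (T : eqType) (G : (T -> R[i] * R[i]) -> R[i]) (s : seq T) :
  uniq s -> (forall t, t \in s -> linear_at G t) ->
  forall x z,
  (forall x', (forall t, t \notin s -> x' t = x t) ->
     (forall t, t \in s -> exists2 y, ~ prodset 1 (- y) & x' t = (1, y)) ->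
     G x' != 0) ->
  ~ prodset (size s) (- z) ->
  G (upd s (1, 0) x) + z * G (upd s (0, 1) x) != 0.
Proof.
elim: s => [|t s IH] /= => [_ _ x z Gx Nz|/andP[ts us] lin x z Gx Nz].
  rewrite !upd_nil -[X in X + _]mul1r -mulrDl mulf_neq0 //; last first.
    by apply: Gx.
  apply/negP => /eqP z1; apply: Nz.
  have -> : - z = 1 by rewrite -[LHS]add0r -z1 addrK.
  exact: prodset0_1.
have lin_s t' : t' \in s -> linear_at G t'.
  by move=> t's; apply: lin; rewrite inE t's orbT.
rewrite [z * _]mulrC.
(* i is the common value on s and j the value at t; contraction keeps only the diagonal terms. *)
pose g i j := G (upd s (if i then (0, 1) else (1, 0))
                  (upd [:: t] (if j then (0, 1) else (1, 0)) x)).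
have -> : G (upd (t :: s) (1, 0) x) = g false false by rewrite upd_cons.
have -> : G (upd (t :: s) (0, 1) x) = g true true by rewrite upd_cons.
apply: (@asano_prodset (size s) _ (g true false) (g false true)) => // z1 z2 N1 N2.
have := IH us lin_s (upd [:: t] (1, z2) x) z1.
rewrite !(upd_swap _ _ _ ts).
have lint : linear_at G t by apply: lin; rewrite mem_head.
rewrite ![G (upd [:: t] (1, z2) _)]lint -!(upd_swap _ _ _ ts).
rewrite -/(g false false) -/(g true false) -/(g false true) -/(g true true).
rewrite (_ : _ + _ = g false false + g true false * z1 + g false true * z2 +
  g true true * z1 * z2); last by rewrite /g /=; ring.
apply => // x' x'E x's; apply: Gx => u.
  rewrite inE negb_or => /andP[ut us']; rewrite x'E // /upd inE.
  by rewrite (negPf ut).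
rewrite inE => /predU1P[->|/x's //]; exists z2 => //.
by rewrite x'E // /upd inE eqxx.
Qed.

End Radial.

(** * The region L in the complex plane *)

Section AbsArg.
Variable R : realType.
Implicit Types u v : R[i].

(** A real-valued modulus; the norm of [R[i]] takes values in [R[i]]. *)
Definition cabs u : R := Num.sqrt (complex.Re u ^+ 2 + complex.Im u ^+ 2).

(* |arg u|, with values in [0, pi]; the value at u = 0 is pi / 2. *)
Definition carg u : R := acos (complex.Re u / cabs u).

Lemma sqr_cabs u : cabs u ^+ 2 = complex.Re u ^+ 2 + complex.Im u ^+ 2.
Proof. by rewrite sqr_sqrtr // addr_ge0 ?sqr_ge0. Qed.

Lemma cabs_ge0 u : 0 <= cabs u. Proof. exact: sqrtr_ge0. Qed.

Lemma cabs_gt0 u : u != 0 -> 0 < cabs u.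
Proof.
case: u => a b; rewrite eq_complex /= negb_and /cabs /= => ab.
rewrite sqrtr_gt0 lt0r addr_ge0 ?sqr_ge0 // andbT.
by rewrite paddr_eq0 ?sqr_ge0 // !sqrf_eq0 negb_and.
Qed.

Lemma cabsM u v : cabs (u * v) = cabs u * cabs v.
Proof.
rewrite /cabs -sqrtrM ?addr_ge0 ?sqr_ge0 //; congr Num.sqrt.
by case: u v => a b [c d] /=; ring.
Qed.

Lemma cabs1 : cabs 1 = 1.
Proof. by rewrite /cabs /= expr1n expr0n addr0 sqrtr1. Qed.

Lemma Re_div_cabs u : -1 <= complex.Re u / cabs u <= 1.
Proof.
rewrite -ler_norml normrM normfV (ger0_norm (cabs_ge0 u)).
have [->|u0] := eqVneq u 0; first by rewrite /= normr0 mul0r.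
rewrite ler_pdivrMr ?cabs_gt0 // mul1r -sqrtr_sqr ler_sqrt.
  by rewrite lerDl sqr_ge0.
by rewrite addr_ge0 ?sqr_ge0.
Qed.

Lemma carg_bounds u : 0 <= carg u <= pi.
Proof. by rewrite acos_ge0 ?acos_lepi // Re_div_cabs. Qed.

Lemma cos_carg u : u != 0 -> cos (carg u) * cabs u = complex.Re u.
Proof.
move=> u0; rewrite acosK ?in_itv /= ?Re_div_cabs // divfK //.
by rewrite gt_eqF // cabs_gt0.
Qed.

Lemma sin_carg u : u != 0 -> sin (carg u) * cabs u = `|complex.Im u|.
Proof.
move=> u0; apply/eqP; rewrite -(@eqrXn2 _ 2) //; last first.
  by rewrite mulr_ge0 ?cabs_ge0 // sin_ge0_pi // carg_bounds.
rewrite exprMn sin2cos2 mulrBl -exprMn cos_carg // mul1r sqr_cabs.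
by rewrite real_normK ?num_real // [X in X - _]addrC addrK.
Qed.

(** If it failed, both sides would lie in [0, pi], where cosine decreases; but Re (u v) >= Re u Re v
    - |Im u Im v|. *)
Lemma cargM_le u v : u != 0 -> v != 0 -> carg (u * v) <= carg u + carg v.
Proof.
move=> u0 v0; rewrite leNgt; apply/negP => lt_uv.
have /andP[u1 u2] := carg_bounds u.
have /andP[v1 v2] := carg_bounds v.
have /andP[w1 w2] := carg_bounds (u * v).
have : cos (carg (u * v)) < cos (carg u + carg v).
  by rewrite ltr_cos // in_itv /=; lra.
apply/negP; rewrite -leNgt cosD.
rewrite -(ler_pM2r (_ : 0 < cabs (u * v))) ?cabs_gt0 ?mulf_neq0 //.
rewrite cos_carg ?mulf_neq0 // cabsM.
have -> : (cos (carg u) * cos (carg v) - sin (carg u) * sin (carg v)) *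
    (cabs u * cabs v) =
  (cos (carg u) * cabs u) * (cos (carg v) * cabs v) -
  (sin (carg u) * cabs u) * (sin (carg v) * cabs v) by ring.
rewrite !cos_carg // !sin_carg // -normrM.
case: u v {u0 v0 lt_uv u1 u2 v1 v2 w1 w2} => [a b] [c d] /=.
by rewrite lerD2l lerN2 ler_norm.
Qed.

End AbsArg.

Section Region.
Variables (R : realType) (s t : R).
Hypotheses (s0 : 0 <= s) (t0 : 0 < t) (t2 : t < pi / 2).
Let A := Acoef s t.
Let B := Bcoef s t.

(** A disc complement for A > 0, a half-plane for A = 0, a disc for A < 0; dividing by |u|^2 gives
    [ray] at y = 1 / |u|. *)
Definition region (u : R[i]) : Prop :=
  1 <= A * cabs u ^+ 2 + B * complex.Re u.

Lemma region_neq0 u : region u -> u != 0.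
Proof.
move=> Lu; apply/eqP => u0; move: Lu; rewrite u0 /region /cabs /=.
rewrite !(expr0n, mulr0, addr0) /= sqrtr0 !(expr0n, mulr0, addr0) /=.
by rewrite ler10.
Qed.

Lemma region_ray u : region u -> ray s t (carg u) (cabs u)^-1.
Proof.
move=> Lu; have u0 := region_neq0 Lu; have c0 := cabs_gt0 u0.
rewrite /ray -/A -/B -(pmulr_rle0 _ (exprn_gt0 2 c0)).
have -> : cabs u ^+ 2 * ((cabs u)^-1 ^+ 2 - B * cos (carg u) / cabs u - A) =
    1 - (A * cabs u ^+ 2 + B * (cos (carg u) * cabs u)).
  by field; rewrite gt_eqF.
by rewrite cos_carg // subr_le0.
Qed.

Lemma cabs_prod_ge1 (l : seq R[i]) : (forall u, u \in l -> region u) ->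
  (cabs (\prod_(u <- l) u))^-1 <= 1.
Proof.
elim: l => [|u l IH] Ll; first by rewrite big_nil cabs1 invr1.
have Lu : region u by apply: Ll; rewrite mem_head.
rewrite big_cons cabsM invfM mulr_ile1 ?invr_ge0 ?cabs_ge0 //.
  apply: (ray_le1 s0 t0 t2 (carg_bounds u)); last exact: region_ray.
  by rewrite invr_gt0 cabs_gt0 // region_neq0.
by apply: IH => v vl; apply: Ll; rewrite inE vl orbT.
Qed.

Lemma cabs_pair u v : region u -> region v ->
  (cabs (u * v))^-1 <= expR (- (s * Num.min pi (carg u + carg v))).
Proof.
move=> Lu Lv; rewrite cabsM invfM.
have u0 := region_neq0 Lu; have v0 := region_neq0 Lv.
apply: (ray_pair s0 t0 t2 (carg_bounds u) (carg_bounds v));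
  rewrite ?invr_gt0 ?cabs_gt0 //; exact: region_ray.
Qed.

(** Induction on l. A factor of angle at most pi / 2 obeys the spiral bound alone and can be split
    off. If w and u are both obtuse, their pair already attains exp (s pi), and the remaining
    factors have modulus at least 1. *)
Lemma cabs_prod2 u v (l : seq R[i]) : region u -> region v ->
  (forall w, w \in l -> region w) ->
  (cabs (u * v * \prod_(w <- l) w))^-1 <=
    expR (- (s * carg (u * v * \prod_(w <- l) w))).
Proof.
elim: l u v => [|w l IH] u v Lu Lv Ll.
  rewrite big_nil mulr1; apply: le_trans (cabs_pair Lu Lv) _.
  apply: expRNs_le => //; rewrite le_min cargM_le ?region_neq0 //.
  by case/andP: (carg_bounds (u * v)) => _ ->.
have Lw : region w by apply: Ll; rewrite mem_head.
have {}Ll z : z \in l -> region z by move=> zl; apply: Ll; rewrite inE zl orbT.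
have l0 : \prod_(z <- l) z != 0.
  by rewrite prodf_seq_neq0; apply/allP => z /Ll /region_neq0 ->.
have acute x y z : region x -> region y -> region z -> carg z <= pi / 2 ->
    (cabs (z * (x * y * \prod_(z <- l) z)))^-1 <=
    expR (- (s * carg (z * (x * y * \prod_(z <- l) z)))).
  move=> Lx Ly Lz z2; rewrite cabsM invfM.
  apply: le_trans (_ : expR (- (s * (carg z + carg (x * y * \prod_(z <- l) z)))) <= _).
    rewrite mulrDr opprD expRD ler_pM ?invr_ge0 ?cabs_ge0 ?IH //.
    apply: (ray_le s0 t0 t2); last exact: region_ray.
    by rewrite z2 andbT; case/andP: (carg_bounds z).
  have x0 := region_neq0 Lx; have y0 := region_neq0 Ly.
  apply: expRNs_le => //; apply: cargM_le; first exact: region_neq0 Lz.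
  by rewrite !mulf_neq0.
rewrite big_cons.
have [w2|w2] := leP (carg w) (pi / 2).
  by rewrite mulrCA; apply: acute.
have [u2|u2] := leP (carg u) (pi / 2).
  have -> : u * v * (w * \prod_(z <- l) z) = u * (v * w * \prod_(z <- l) z).
    by ring.
  exact: acute.
apply: le_trans (_ : expR (- (s * pi)) <= _); last first.
  by apply: expRNs_le => //; case/andP: (carg_bounds (u * v * (w * \prod_(z <- l) z))).
have -> : u * v * (w * \prod_(z <- l) z) = u * w * (\prod_(z <- (v :: l)) z).
  by rewrite big_cons; ring.
rewrite cabsM invfM -[leRHS]mulr1 ler_pM ?invr_ge0 ?cabs_ge0 //.
  apply: le_trans (cabs_pair Lu Lw) _; apply: expRNs_le => //.
  by rewrite le_min lexx /=; lra.
by apply: cabs_prod_ge1 => z; rewrite inE => /predU1P[->|/Ll].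
Qed.

Lemma discr_gt0 : 0 < B ^+ 2 + 4 * A.
Proof.
have := Bcos_lt_t s0 t0 t2; rewrite -/B => q.
rewrite /A /Acoef -/B; set Y := expR _ in q *.
have -> : B ^+ 2 + 4 * (Y ^+ 2 - B * cos t * Y) =
    (2 * Y - B * cos t) ^+ 2 + B ^+ 2 * sin t ^+ 2.
  by rewrite sin2cos2; ring.
apply: ltr_pwDl; last by rewrite mulr_ge0 ?sqr_ge0.
by rewrite exprn_gt0 // subr_gt0.
Qed.

Lemma cabsR (x : R) : cabs x%:C ^+ 2 = x ^+ 2.
Proof. by rewrite sqr_cabs /= expr0n addr0. Qed.

Lemma region_real : exists c : R, [/\ 0 < c, region c%:C &
  forall x : R, 0 < x < c -> ~ region x%:C].
Proof.
have D0 := discr_gt0.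
have B0 := Bcoef_ge0 s0 t0 t2; rewrite -/B in B0.
pose D := Num.sqrt (B ^+ 2 + 4 * A).
have Dp : 0 < D by rewrite sqrtr_gt0.
have D2 : D ^+ 2 = B ^+ 2 + 4 * A by rewrite sqr_sqrtr // ltW.
(* The larger root on the ray of angle 0; lengths are inverted, so its inverse is the first point of
   the region. *)
pose y := (B + D) / 2.
have y0 : 0 < y by rewrite /y; lra.
have yE : y ^+ 2 - B * y - A = 0.
  have -> : A = (D ^+ 2 - B ^+ 2) / 4 by rewrite D2; field.
  by rewrite /y; field.
exists y^-1; split; first by rewrite invr_gt0.
  rewrite /region cabsR /= -(ler_pM2r (exprn_gt0 2 y0)) mul1r.
  have -> : (A * y^-1 ^+ 2 + B * y^-1) * y ^+ 2 = A + B * y.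
    by field; rewrite gt_eqF.
  lra.
move=> x /andP[x0 xy] Lx.
pose w := x^-1.
have yw : y < w by rewrite -[y]invrK ltf_pV2 ?posrE ?invr_gt0.
have w0 : 0 < w by rewrite invr_gt0.
have : w ^+ 2 - B * w - A <= 0.
  move: Lx; rewrite /region cabsR /= -[x]invrK -/w.
  rewrite -(ler_pM2r (exprn_gt0 2 w0)) mul1r.
  have -> : (A * w^-1 ^+ 2 + B * w^-1) * w ^+ 2 = A + B * w.
    by field; rewrite gt_eqF.
  lra.
apply/negP; rewrite -ltNge.
have : 0 < (w - y) * (w + y - B).
  by rewrite mulr_gt0 ?subr_gt0 // /y; rewrite /y in yw; lra.
lra.
Qed.

Variables (beta gamma : R).
Hypotheses (hg : 1 < beta * gamma) (hAB : A * beta + B = gamma).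

(** A zero means z2 (1 + gamma z1) = - (beta + z1), with p + i q = 1 + gamma z1. By [hAB], this
    involution multiplies the defect of - z1 from the region by - (beta gamma - 1), up to |p + i
    q|^2, so - z2 would fall in the region. *)
Lemma edge_neq0 (z1 z2 : R[i]) : ~ region (- z1) -> ~ region (- z2) ->
  beta%:C + z1 + z2 + gamma%:C * z1 * z2 != 0.
Proof.
case: z1 z2 => [x1 y1] [x2 y2]; rewrite /region !sqr_cabs /= => /negP N1 /negP N2.
rewrite -ltNge !sqrrN in N1; rewrite -ltNge !sqrrN in N2.
apply/negP; rewrite eq_complex /= => /andP[/eqP e1 /eqP e2].
pose p := 1 + gamma * x1; pose q := gamma * y1.
have E1 : x2 * p - y2 * q = - (beta + x1).
  by rewrite -[RHS]add0r -e1 /p /q; ring.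
have E2 : x2 * q + y2 * p = - y1 by rewrite -[RHS]add0r -e2 /p /q; ring.
(* If 1 + gamma z1 = 0 then also z1 = - beta, whence beta gamma = 1. *)
have n0 : 0 < p ^+ 2 + q ^+ 2.
  rewrite lt0r addr_ge0 ?sqr_ge0 // andbT paddr_eq0 ?sqr_ge0 // !sqrf_eq0.
  apply/negP => /andP[/eqP p0 /eqP q0].
  have x1E : x1 = - beta by move: E1; rewrite p0 q0 !mulr0; lra.
  by move: p0 (hg); rewrite /p x1E; lra.
have H : (A * (x2 ^+ 2 + y2 ^+ 2) + B * - x2) * (p ^+ 2 + q ^+ 2) =
  A * ((x2 * p - y2 * q) ^+ 2 + (x2 * q + y2 * p) ^+ 2) -
  B * (p * (x2 * p - y2 * q) + q * (x2 * q + y2 * p)) by ring.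
have : (A * (x2 ^+ 2 + y2 ^+ 2) + B * - x2) * (p ^+ 2 + q ^+ 2) <
   1 * (p ^+ 2 + q ^+ 2) by rewrite ltr_pM2r.
rewrite H E1 E2 mul1r.
apply/negP; rewrite -leNgt -subr_ge0.
have -> : A * ((- (beta + x1)) ^+ 2 + (- y1) ^+ 2) -
    B * (p * - (beta + x1) + q * - y1) - (p ^+ 2 + q ^+ 2) =
  (beta * gamma - 1) * (1 - (A * (x1 ^+ 2 + y1 ^+ 2) + B * - x1)).
  by rewrite /p /q -hAB; ring.
by rewrite mulr_ge0 ?subr_ge0 // ltW.
Qed.

End Region.

(** * Contracting a graph vertex by vertex *)

Section HalfEdges.
Variables (R : realType) (V : finType) (e : rel V).
Hypotheses (e_sym : symmetric e) (eirr : irreflexive e).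
Variables (b g lam : R[i]).
Local Notation coord := (R[i] * R[i])%type.
Implicit Types (x : V * V -> coord) (vs : seq V).

(* One orientation per edge. *)
Definition arcs : {set V * V} :=
  [set p | e p.1 p.2 && (enum_rank p.1 < enum_rank p.2)%N].

Definition swp (p : V * V) := (p.2, p.1).

Definition edgeform (p q : coord) : R[i] :=
  b * p.1 * q.1 + p.1 * q.2 + p.2 * q.1 + g * p.2 * q.2.

Definition edgeprod x : R[i] := \prod_(p in arcs) edgeform (x p) (x (swp p)).

Definition star (v : V) : seq (V * V) := [seq (v, w) | w <- enum V & e v w].

Lemma mem_star v p : (p \in star v) = (p.1 == v) && e p.1 p.2.
Proof.
apply/mapP/andP => [[w]|[/eqP <- ep]].
  by rewrite mem_filter => /andP[vw _] ->.
by exists p.2; [rewrite mem_filter ep mem_enum | case: p ep].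
Qed.

Lemma star_uniq v : uniq (star v).
Proof. by rewrite map_inj_uniq => [|a c [->] //]; exact: filter_uniq (enum_uniq _). Qed.

Lemma size_star v : size (star v) = degree e v.
Proof.
rewrite size_map /degree cardE; congr size; rewrite [RHS]/enum_mem -enumT.
by apply: eq_filter => w; rewrite -[RHS]/(w \in [set w | e v w]) inE.
Qed.

(* The vertices of vs have been contracted. *)
Fixpoint Zpart vs x : R[i] :=
  if vs is v :: vs' then
    Zpart vs' (upd (star v) (1, 0) x) + lam * Zpart vs' (upd (star v) (0, 1) x)
  else edgeprod x.

(** Exactly one of p and [swp p] is an arc, so the half-edge p occurs in a single factor. *)
Lemma edgeprod_linear p : e p.1 p.2 -> linear_at edgeprod p.
Proof.
move=> ep x c d.
have pp : p != swp p.
  case: p ep => u v /= uv; apply/eqP => -[uv' _].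
  by move: uv; rewrite uv' eirr.
have swpK q : swp (swp q) = q by case: q.
have outside q : q \in arcs -> q != p -> q != swp p -> forall c',
    edgeform (upd [:: p] c' x q) (upd [:: p] c' x (swp q)) =
    edgeform (x q) (x (swp q)).
  move=> _ qp qsp c'; rewrite /upd !inE (negPf qp) -(inj_eq (can_inj swpK)) swpK.
  by rewrite (negPf qsp).
have pick : (p \in arcs) && (swp p \notin arcs) || (p \notin arcs) && (swp p \in arcs).
  rewrite !inE /= [e p.2 _]e_sym ep /=.
  case: ltngtP => // /ord_inj /enum_rank_inj h.
  by move: ep; rewrite h eirr.
rewrite /edgeprod.
case/orP: pick => /andP[pa spa].
- rewrite !(bigD1 p pa) /=.
  have rest c' : \prod_(q in arcs | q != p)
      edgeform (upd [:: p] c' x q) (upd [:: p] c' x (swp q)) =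
      \prod_(q in arcs | q != p) edgeform (x q) (x (swp q)).
    apply: eq_bigr => q /andP[qa qp]; apply: outside => //.
    by apply: contraNneq spa => <-.
  rewrite !rest /upd !inE eqxx [swp p == p]eq_sym (negPf pp) /edgeform /=; ring.
- rewrite !(bigD1 (swp p) spa) /=.
  have rest c' : \prod_(q in arcs | q != swp p)
      edgeform (upd [:: p] c' x q) (upd [:: p] c' x (swp q)) =
      \prod_(q in arcs | q != swp p) edgeform (x q) (x (swp q)).
    apply: eq_bigr => q /andP[qa qp]; apply: outside => //.
    by apply: contraNneq pa => <-.
  rewrite !rest swpK /upd !inE eqxx [swp p == p]eq_sym (negPf pp) /edgeform /=; ring.
Qed.

Lemma upd_star_swap v p c c' x : p.1 != v ->
  upd (star v) c (upd [:: p] c' x) = upd [:: p] c' (upd (star v) c x).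
Proof. by move=> pv; rewrite upd_swap // mem_star (negPf pv). Qed.

Lemma Zpart_linear vs p : e p.1 p.2 -> p.1 \notin vs -> linear_at (Zpart vs) p.
Proof.
move=> ep; elim: vs => [|v vs IH] /=; first by move=> _; exact: edgeprod_linear.
rewrite inE negb_or => /andP[pv pvs] x c d.
rewrite !upd_star_swap // ![Zpart vs (upd [:: p] (c, d) _)](IH pvs); ring.
Qed.

Variables (L : R[i] -> Prop) (c : R).
Hypotheses (L0 : ~ L 0) (c0 : 0 < c) (Lc : L c%:C).
Hypothesis Lltc : forall y : R, 0 < y < c -> ~ L y%:C.
Hypothesis edgeL : forall z1 z2, ~ L (- z1) -> ~ L (- z2) ->
  b + z1 + z2 + g * z1 * z2 != 0.
Hypothesis lamL : forall v, ~ prodset L (degree e v) (- lam).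

(** Half-edges at vertices of vs get overwritten, so only the others are constrained; each vertex is
    one application of [contraction] to its star. *)
Lemma Zpart_neq0 vs x : uniq vs ->
  (forall p, e p.1 p.2 -> p.1 \notin vs ->
     exists2 y, ~ prodset L 1 (- y) & x p = (1, y)) ->
  Zpart vs x != 0.
Proof.
elim: vs x => [|v vs IH] x /= => [_ good|/andP[vvs uvs] good].
  rewrite /edgeprod; apply/prodf_neq0 => p; rewrite inE => /andP[ep _].
  have [y1 N1 ->] := good p ep isT.
  have [y2 N2 ->] := good (swp p) ltac:(by rewrite e_sym) isT.
  rewrite /edgeform /= !mulr1 mul1r.
  rewrite (_ : _ + _ = b + y1 + y2 + g * y1 * y2); last by ring.
  by apply: edgeL => Ly; [apply: N1|apply: N2]; exact: sub_prodset1.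
apply: (contraction L0 c0 Lc Lltc (star_uniq v)).
- move=> p; rewrite mem_star => /andP[/eqP pv ep].
  by apply: Zpart_linear => //; rewrite pv.
- move=> x' x'E x's; apply: IH => // p ep pvs.
  have [pv|pv] := boolP (p \in star v); first exact: x's.
  rewrite x'E //; apply: good => //.
  by rewrite inE negb_or pvs andbT; move: pv; rewrite mem_star ep andbT.
- by rewrite size_star.
Qed.

(** * The full contraction is the partition function *)

Definition spin (i : bool) : coord := if i then (0, 1) else (1, 0).

Definition raise (v : V) (sigma : {ffun V -> bool}) : {ffun V -> bool} :=
  [ffun w => (w == v) || sigma w].

Definition lower (v : V) (sigma : {ffun V -> bool}) : {ffun V -> bool} :=
  [ffun w => (w != v) && sigma w].

Definition supported vs (sigma : {ffun V -> bool}) :=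
  [forall v, sigma v ==> (v \in vs)].

Lemma sum_supported_cons v vs (F : {ffun V -> bool} -> R[i]) : v \notin vs ->
  \sum_(sigma | supported (v :: vs) sigma) F sigma =
  \sum_(sigma | supported vs sigma) F sigma +
  \sum_(sigma | supported vs sigma) F (raise v sigma).
Proof.
move=> vvs; rewrite (bigID (fun sigma : {ffun V -> bool} => sigma v)) /= addrC.
congr (_ + _).
  apply: eq_bigl => sigma; apply/andP/forallP => [[/forallP h sv] w|h].
    apply/implyP => sw; have := implyP (h w) sw.
    by rewrite inE => /predU1P[wv|//]; rewrite -wv sw in sv.
  split; last by apply: contra vvs => /(implyP (h v)).
  by apply/forallP => w; apply/implyP => /(implyP (h w)); rewrite inE orbC => ->.
rewrite (reindex_onto (raise v) (lower v)) /=; last first.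
  move=> sigma /andP[_ sv]; apply/ffunP => w; rewrite !ffunE.
  by case: eqVneq => // ->.
apply: eq_bigl => sigma; rewrite ffunE eqxx andbT /=.
apply/andP/forallP => [[/forallP h /eqP s1] w|h].
  apply/implyP => sw; have : raise v sigma w by rewrite ffunE sw orbT.
  move/(implyP (h w)); rewrite inE => /predU1P[wv|//].
  by move: sw; rewrite -s1 ffunE wv eqxx.
split.
  apply/forallP => w; apply/implyP; rewrite ffunE inE.
  by case/orP => [->//|/(implyP (h w)) ->]; rewrite orbT.
apply/eqP/ffunP => w; rewrite !ffunE; case: eqVneq => //= ->.
by apply/esym; apply: contraNF vvs => /(implyP (h v)).
Qed.

Definition assign vs (sigma : {ffun V -> bool}) x : V * V -> coord :=
  fun p => if (p.1 \in vs) && e p.1 p.2 then spin (sigma p.1) else x p.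

Lemma ones_raise v (sigma : {ffun V -> bool}) :
  ~~ sigma v -> ones (raise v sigma) = (ones sigma).+1.
Proof.
move=> sv; rewrite /ones (_ : [set w | raise v sigma w] = v |: [set w | sigma w]).
  by rewrite cardsU1 inE sv.
by apply/setP => w; rewrite !inE ffunE.
Qed.

(** Contracting v gives all its half-edges one common spin, with weight [lam] for spin 1. *)
Lemma Zpart_sum vs x : uniq vs -> Zpart vs x =
  \sum_(sigma | supported vs sigma) lam ^+ ones sigma * edgeprod (assign vs sigma x).
Proof.
elim: vs x => [|v vs IH] x /= => [_|/andP[vvs uvs]].
  rewrite (bigD1 [ffun=> false]) /=; last by apply/forallP => w; rewrite ffunE.
  rewrite big1 => [|sigma /andP[/forallP h /eqP sne]]; last first.
    case: sne; apply/ffunP => w; rewrite ffunE; apply/negbTE/negP => sw.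
    by have := implyP (h w) sw.
  rewrite addr0 (_ : ones _ = 0)%N ?expr0 ?mul1r; last first.
    by apply: eq_card0 => w; rewrite !inE ffunE.
  by congr edgeprod; apply/funext => p; rewrite /assign in_nil.
rewrite !IH // sum_supported_cons // big_distrr /=.
have sigv sigma : supported vs sigma -> ~~ sigma v.
  by move=> /forallP h; apply: contra vvs => /(implyP (h v)).
congr (_ + _); apply: eq_bigr => sigma /sigv sv.
  congr (_ * edgeprod _); apply/funext => p; rewrite /assign /upd mem_star inE.
  case: eqVneq => [pv|] //=; rewrite pv (negPf vvs) /=.
  by case: ifP => // _; rewrite (negPf sv).
rewrite ones_raise // exprS mulrA; congr (_ * edgeprod _).
apply/funext => p; rewrite /assign /upd mem_star inE ffunE.
by case: eqVneq => [pv|] //=; rewrite pv (negPf vvs) /=.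
Qed.

(** Forgetting the orientation is a bijection from arcs to edges. *)
Lemma mono_edgesE i (sigma : {ffun V -> bool}) : mono_edges e i sigma =
  #|[set p in arcs | (sigma p.1 == i) && (sigma p.2 == i)]|.
Proof.
rewrite /mono_edges -(@card_in_imset _ _ (fun p : V * V => [set p.1; p.2])).
  apply: eq_card => f; rewrite !inE.
  apply/andP/imsetP => [[/imset2P[u v _]]|[p]].
    rewrite inE /= => uv -> /forallP h.
    have su : sigma u == i by apply: (implyP (h u)); rewrite !inE eqxx.
    have sv : sigma v == i by apply: (implyP (h v)); rewrite !inE eqxx orbT.
    case: (ltngtP (enum_rank u) (enum_rank v)) => [luv|luv|/ord_inj/enum_rank_inj uv'].
    - by exists (u, v) => //; rewrite !inE /= uv luv su sv.
    - by exists (v, u); [rewrite !inE /= e_sym uv luv su sv | exact: finset.setUC].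
    - by move: uv; rewrite uv' eirr.
  rewrite !inE => /andP[/andP[ep _] /andP[s1 s2]] ->; split.
    by apply/imset2P; exists p.1 p.2; rewrite ?inE.
  by apply/forallP => w; apply/implyP; rewrite !inE => /orP[] /eqP ->.
move=> [u v] [u' v'] /=; rewrite !inE /=.
move=> /andP[/andP[_ luv] _] /andP[/andP[_ luv'] _] E.
have : u \in [set u'; v'] by rewrite -E !inE eqxx.
have : v \in [set u'; v'] by rewrite -E !inE eqxx orbT.
rewrite !inE => /orP[] /eqP vE /orP[] /eqP uE; subst => //.
- by rewrite ltnn in luv.
- by move: (ltn_trans luv luv'); rewrite ltnn.
- by rewrite ltnn in luv.
Qed.

Lemma edgeprod_spin (sigma : {ffun V -> bool}) :
  edgeprod (fun p => spin (sigma p.1)) =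
  b ^+ mono_edges e false sigma * g ^+ mono_edges e true sigma.
Proof.
rewrite !mono_edgesE -!prodr_const.
rewrite [X in X * _]big_mkcond [X in _ * X]big_mkcond -big_split /=.
rewrite /edgeprod [LHS]big_mkcond /=; apply: eq_bigr => p _; rewrite !inE.
case: (e p.1 p.2 && _); last by rewrite /= mulr1.
rewrite /edgeform /=; case: (sigma p.1); case: (sigma p.2) => /=; ring.
Qed.

Lemma Zspin_Zpart x : Zspin e b g lam = Zpart (enum V) x.
Proof.
rewrite Zpart_sum ?enum_uniq // /Zspin.
apply: eq_big => [sigma|sigma _].
  by apply/esym/forallP => v; rewrite mem_enum implybT.
rewrite mulrC; congr (_ * _); rewrite -edgeprod_spin /edgeprod.
apply: eq_bigr => p; rewrite inE => /andP[ep _].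
by rewrite /assign /= !mem_enum !inE [e p.2 _]e_sym ep.
Qed.

Lemma Zspin_neq0 : Zspin e b g lam != 0.
Proof.
rewrite (Zspin_Zpart (fun=> 0)); apply: Zpart_neq0; first exact: enum_uniq.
by move=> p _; rewrite mem_enum.
Qed.

End HalfEdges.

(** * Products of elements of the region *)

Lemma cabs_scale (R : realType) (a : R) (u : R[i]) : 0 < a ->
  cabs (a%:C * u) = a * cabs u.
Proof.
move=> a0; rewrite cabsM; congr (_ * _).
by rewrite /cabs /= expr0n addr0 sqrtr_sqr ger0_norm // ltW.
Qed.

Lemma carg_scale (R : realType) (a : R) (u : R[i]) : 0 < a ->
  carg (a%:C * u) = carg u.
Proof.
move=> a0; rewrite /carg cabs_scale //.
have -> : complex.Re (a%:C * u) = a * complex.Re u by case: u => x y /=; ring.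
by rewrite -mulf_div divff ?mul1r // gt_eqF.
Qed.

(** [carg] is invariant under positive scaling, so the bound of [cabs_prod2] survives the radial
    closure: a tolerance strictly between 1 and q would contradict it. *)
Lemma prodset_region (R : realType) (s t : R) (d : nat) (p : R[i]) :
  0 <= s -> 0 < t -> t < pi / 2 -> (2 <= d)%N -> p != 0 ->
  prodset (region s t) d p -> expR (s * carg p) <= cabs p.
Proof.
move=> s0 t0 t2 d2 p0 Np; rewrite leNgt; apply/negP => lt_p.
have c0 := cabs_gt0 p0.
pose q := expR (s * carg p) / cabs p.
have q1 : 1 < q by rewrite ltr_pdivlMr // mul1r.
have [a /andP[a0 aq] [l [sl Ll] lE]] := Np ((1 + q) / 2) ltac:(lra).
have : a < q by lra.
rewrite /q ltr_pdivlMr // -cabs_scale // -(carg_scale p a0) lE.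
case: l sl Ll {lE} => [|u [|v l]] /= => [sl|sl|_ Ll].
- by move: d2; rewrite -sl.
- by move: d2; rewrite -sl.
have Lu : region s t u by apply: Ll; rewrite mem_head.
have Lv : region s t v by apply: Ll; rewrite !inE eqxx orbT.
have {}Ll w : w \in l -> region s t w.
  by move=> wl; apply: Ll; rewrite !inE wl !orbT.
rewrite !big_cons mulrA; apply/negP; rewrite -leNgt.
have P0 : u * v * \prod_(w <- l) w != 0.
  rewrite !mulf_neq0 ?(region_neq0 Lu) ?(region_neq0 Lv) //.
  by rewrite prodf_seq_neq0; apply/allP => w /Ll /region_neq0 ->.
have := cabs_prod2 s0 t0 t2 Lu Lv Ll.
by rewrite expRN lef_pV2 ?posrE ?expR_gt0 ?cabs_gt0.
Qed.

Lemma cabs_le (R : realType) (z : R[i]) :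
  cabs z <= `|complex.Re z| + `|complex.Im z|.
Proof.
rewrite -(@ler_pXn2r _ 2) ?nnegrE ?cabs_ge0 ?addr_ge0 // sqr_cabs.
rewrite -[complex.Re z ^+ 2]real_normK ?num_real //.
rewrite -[complex.Im z ^+ 2]real_normK ?num_real //.
have := mulr_ge0 (normr_ge0 (complex.Re z)) (normr_ge0 (complex.Im z)).
lra.
Qed.

(** Points with |z| < 1 are below the spiral at every angle. The others have Re z > 0 and - z within
    angle eps of the negative axis, where the spiral radius is close to M. *)
Lemma strip_in_spiral (R : realType) (s m : R) : 0 <= s -> 0 <= m ->
  m < expR (s * pi) ->
  exists2 delta : R, 0 < delta & forall z : R[i], `|complex.Im z| <= delta ->
    - delta <= complex.Re z -> complex.Re z <= m + delta ->
    cabs z < expR (s * carg (- z)).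
Proof.
move=> s0 m0; set M := expR (s * pi) => mM.
have M0 : 0 < M := expR_gt0 _.
have sM : 0 <= s * M by rewrite mulr_ge0 // ltW.
(* Chosen so that M (1 - s eps) >= (M + m) / 2. *)
pose eps := Num.min (pi / 2) ((M - m) / (2 * (s * M + 1))).
have pi0 := pi_gt0 R.
have eps0 : 0 < eps.
  by rewrite lt_min divr_gt0 //= divr_gt0 ?subr_gt0 // mulr_gt0 //; lra.
have eps2 : eps <= pi / 2 by rewrite ge_min lexx.
have epsM : eps * (s * M) <= (M - m) / 2.
  apply: le_trans (_ : (M - m) / (2 * (s * M + 1)) * (s * M + 1) <= _).
    apply: ler_pM; rewrite ?(ltW eps0) //; last lra.
    by rewrite /eps ge_min lexx orbT.
  rewrite le_eqVlt; apply/orP; left; apply/eqP; field.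
  by rewrite gt_eqF //; lra.
have sin0 : 0 < sin eps by apply: sin_gt0_pi; lra.
(* The bound 1 / 2 forces Re z > 0 once |z| >= 1, (M - m) / 8 keeps |z| below (M + m) / 2, and sin
   eps controls the angle. *)
pose delta := Num.min (1 / 2) (Num.min ((M - m) / 8) (sin eps)).
exists delta; first by rewrite !lt_min sin0 !divr_gt0 ?subr_gt0.
have d1 : delta <= 1 / 2 by rewrite ge_min lexx.
have d2 : delta <= (M - m) / 8 by rewrite !ge_min lexx orbT.
have d3 : delta <= sin eps by rewrite !ge_min lexx !orbT.
move=> z imz rez rez'.
have [z1|z1] := ltP (cabs z) 1.
  apply: lt_le_trans z1 _; rewrite -expR0 ler_expR mulr_ge0 //.
  by case/andP: (carg_bounds (- z)).
have z0 : - z != 0.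
  apply/eqP => /eqP; rewrite oppr_eq0 => /eqP z0; move: z1.
  by rewrite z0 /cabs /= expr0n addr0 sqrtr0 ler10.
have cN : cabs (- z) = cabs z by rewrite /cabs; case: (z) => a b /=; rewrite !sqrrN.
have im2 : complex.Im z ^+ 2 <= delta ^+ 2.
  rewrite -[complex.Im z ^+ 2]real_normK ?num_real // ler_pXn2r // nnegrE //.
  exact: le_trans (normr_ge0 _) imz.
have d0 : 0 <= delta := le_trans (normr_ge0 _) imz.
have zz : cabs z ^+ 2 = complex.Re z ^+ 2 + complex.Im z ^+ 2 by rewrite sqr_cabs.
have z12 : 1 <= cabs z ^+ 2 by rewrite exprn_ege1.
have rez0 : 0 < complex.Re z.
  rewrite ltNge; apply/negP => rn.
  have : complex.Re z ^+ 2 <= delta ^+ 2.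
    by rewrite -sqrrN ler_pXn2r ?nnegrE //; lra.
  have : delta ^+ 2 <= (1 / 2) ^+ 2 by rewrite ler_pXn2r ?nnegrE //; lra.
  lra.
have argz : pi - eps <= carg (- z).
  have /andP[a0 api] := carg_bounds (- z).
  rewrite leNgt; apply/negP => lt_arg.
  have : cos (pi - eps) < cos (carg (- z)) by rewrite ltr_cos ?in_itv /=; lra.
  have z00 : 0 < cabs z by lra.
  rewrite cosB cospi sinpi -(ltr_pM2r z00) -{2}cN cos_carg //.
  have -> : complex.Re (- z) = - complex.Re z by case: (z).
  move=> lt_re.
  have {}lt_re : complex.Re z < cos eps * cabs z by lra.
  have : complex.Re z ^+ 2 < (cos eps * cabs z) ^+ 2.
    by rewrite ltr_pXn2r // nnegrE; lra.
  rewrite exprMn cos2sin2.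
  have : sin eps ^+ 2 <= sin eps ^+ 2 * cabs z ^+ 2.
    by rewrite ler_peMr // sqr_ge0.
  have : delta ^+ 2 <= sin eps ^+ 2 by rewrite ler_pXn2r ?nnegrE //; lra.
  lra.
apply: lt_le_trans (_ : expR (s * (pi - eps)) <= _); last first.
  by rewrite ler_expR ler_wpM2l.
rewrite mulrBr expRD -/M.
apply: lt_le_trans (_ : M * (1 - s * eps) <= _); last first.
  by rewrite ler_pM2l // expR_ge1Dx.
have : `|complex.Re z| <= m + delta by rewrite ler_norml; lra.
have := cabs_le z.
lra.
Qed.

(** * The parameters of the spiral *)

Section Angle.
Variables (R : realType) (beta gamma : R).

(** The points of modulus sqrt (beta / gamma) and argument plus or minus [theta] are the negatives
    of the fixed points of the edge involution; [slope] makes the spiral pass through them. *)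
Definition theta : R := atan (Num.sqrt (beta * gamma - 1)).
Definition slope : R := ln (beta / gamma) / (2 * theta).

Hypotheses (hbeta : 0 < beta) (hgamma : 0 < gamma).
Hypotheses (hle : gamma <= beta) (hferro : 1 < beta * gamma).

Lemma theta_gt0 : 0 < theta.
Proof. by rewrite -(atan0 R) lt_atan // sqrtr_gt0 subr_gt0. Qed.

Lemma slope_ge0 : 0 <= slope.
Proof.
rewrite divr_ge0 ?mulr_ge0 ?(ltW theta_gt0) // ln_ge0 //.
by rewrite ler_pdivlMr // mul1r.
Qed.

Lemma sqr_expR_slope : expR (- (slope * theta)) ^+ 2 = gamma / beta.
Proof.
rewrite -expRM_natl mulrN expRN.
have -> : 2%:R * (slope * theta) = ln (beta / gamma).
  by rewrite /slope; field; rewrite gt_eqF // theta_gt0.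
by rewrite lnK ?posrE ?divr_gt0 // invf_div.
Qed.

Lemma beta_cos_theta : beta * cos theta * expR (- (slope * theta)) = 1.
Proof.
have bg : 0 < beta * gamma by rewrite mulr_gt0.
have cos2 : cos theta ^+ 2 = (beta * gamma)^-1.
  rewrite cos_atan exprVn sqr_sqrtr; last by rewrite addr_ge0 ?sqr_ge0.
  rewrite sqr_sqrtr; last by rewrite subr_ge0 ltW.
  by rewrite addrC subrK.
have cos0 : 0 <= cos theta by rewrite cos_atan invr_ge0 sqrtr_ge0.
apply/eqP; rewrite -(@eqrXn2 _ 2) //; last first.
  by rewrite !mulr_ge0 ?expR_ge0 ?(ltW hbeta).
rewrite !exprMn cos2 sqr_expR_slope expr1n; apply/eqP; field.
by rewrite !gt_eqF.
Qed.

(** This invariance of the tangent circle under the edge involution feeds [edge_neq0]; it holds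
    because the circle passes through the point of angle [theta] on the spiral. *)
Lemma Acoef_Bcoef :
  Acoef slope theta * beta + Bcoef slope theta = gamma.
Proof.
rewrite /Acoef sqr_expR_slope mulrBl.
have -> : Bcoef slope theta * cos theta * expR (- (slope * theta)) * beta =
  Bcoef slope theta * (beta * cos theta * expR (- (slope * theta))) by ring.
rewrite beta_cos_theta; field.
by rewrite gt_eqF.
Qed.

Lemma lambdastarE : lambdastar beta gamma = expR (slope * pi).
Proof.
rewrite /lambdastar /powR gt_eqF ?divr_gt0 // /dstar -/theta /slope.
by congr expR; field; rewrite gt_eqF // theta_gt0.
Qed.

End Angle.

Theorem theorem3 (R : realType) (beta gamma : R)
    (hbeta : 0 < beta) (hgamma : 0 < gamma)
    (hle : gamma <= beta) (hferro : 1 < beta * gamma) :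
  forall lambda' : R, lambda' < lambdastar beta gamma ->
  exists2 delta : R, 0 < delta &
  forall (V : finType) (e : rel V),
    symmetric e -> irreflexive e -> (forall v : V, (2 <= degree e v)%N) ->
  forall z : R[i],
    `|complex.Im z| <= delta ->
    - delta <= complex.Re z -> complex.Re z <= lambda' + delta ->
    Zspin e beta%:C gamma%:C z != 0.
Proof.
move=> lambda'; rewrite lambdastarE // => hlambda.
have t0 := theta_gt0 hferro.
have t2 : theta beta gamma < pi / 2 := atan_ltpi2 _.
have s0 := slope_ge0 hgamma hle hferro.
(* The maximum with 0 covers a negative [lambda'] and only enlarges the strip. *)
have [|| delta delta0 hdelta] :=
  @strip_in_spiral R (slope beta gamma) (Num.max 0 lambda') s0.
- by rewrite le_max lexx.
- by rewrite gt_max expR_gt0.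
exists delta => // V e e_sym e_irr deg2 z imz rez rez'.
have [c [c0 Lc Lltc]] := region_real s0 t0 t2.
have L0 : ~ region (slope beta gamma) (theta beta gamma) 0.
  by move/region_neq0; rewrite eqxx.
apply: (Zspin_neq0 e_sym e_irr L0 c0 Lc Lltc).
  by move=> z1 z2; apply: edge_neq0 => //; exact: Acoef_Bcoef.
move=> v Nv.
have [z0|z0] := eqVneq z 0.
  by move: Nv; rewrite z0 oppr0; exact: prodset_neq0.
have Nz0 : - z != 0 by rewrite oppr_eq0.
have := prodset_region s0 t0 t2 (deg2 v) Nz0 Nv.
have -> : cabs (- z) = cabs z.
  by rewrite /cabs; case: (z) => a b /=; rewrite !sqrrN.
apply/negP; rewrite -ltNge; apply: hdelta => //.
by apply: le_trans rez' _; rewrite lerD2r le_max lexx orbT.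
Qed.
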